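(* Let $S$ be a left reversible semigroup with a finite choice of generators $X$, such that $S^1$ satisfies the Klawe condition. If $S$ has maximal global cogrowth (with respect to $X$) then $S$ is left amenable.
   Context: $S^1$ denotes $S$ with an identity element adjoined if $S$ has no identity, and $S^1=S$ otherwise. A semigroup $T$ satisfies the Klawe condition if whenever $s,x,y\in T$ are such that $sx=sy$, there exists $t\in T$ with $xt=yt$. $S$ is left reversible if it does not admit disjoint (non-empty) right ideals. A finite choice of generators for a semigroup $S$ is a finite set $X$ of symbols together with a surjective morphism $X^+\to S$, $w\mapsto\overline{w}$, from the free semigroup on $X$; $|w|$ is the length of a word $w$. The global cogrowth function $\gamma^{S,X}(n)$ ($n\geq1$) is the number of pairs $(u,v)$ of non-empty words over $X$ with $|u|+|v|=n$ and $\overline{u}=\overline{v}$ in $S$. The global cogrowth rate is $\gamma^{S,X}=\limsup_{n\to\infty}(\gamma^{S,X}(n))^{1/n}\leq|X|$; $S$ has maximal global cogrowth (with respect to $X$) if $\gamma^{S,X}=|X|$. $S$ is left amenable if there is a finitely additive probability measure $\mu$, defined on all subsets of $S$, such that $\mu(a^{-1}Y)=\mu(Y)$ for all $Y\subseteq S$ and $a\in S$, where $a^{-1}Y=\{s\in S: as\in Y\}$. *)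

(* Defs.v *)
From HB Require Import structures.
From mathcomp Require Import all_boot all_order all_algebra.
From mathcomp Require Import finmap.
From mathcomp Require Import all_classical all_reals all_analysis.

Set Implicit Arguments.
Unset Strict Implicit.
Unset Printing Implicit Defensive.

Import Order.TTheory GRing.Theory Num.Theory.

Local Open Scope classical_set_scope.

Definition free_semigroup (X : finType) : Type := {w : seq X | w != [::]}.

HB.instance Definition _ (X : finType) := Choice.on (free_semigroup X).

Definition word_length (X : finType) (w : free_semigroup X) : nat :=
  size (val w).

Fact concat_proof (X : finType) (u v : free_semigroup X) :
  val u ++ val v != [::].
Proof. by case: u => -[|x u]. Qed.

Definition concat (X : finType) (u v : free_semigroup X) : free_semigroup X :=
  exist _ (val u ++ val v) (concat_proof u v).

Fact concatA (X : finType) : associative (@concat X).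
Proof. by move=> u v w; apply: val_inj; rewrite /= catA. Qed.

HB.instance Definition _ (X : finType) :=
  isSemigroup.Build (free_semigroup X) (@concatA X).

Section SemigroupNotions.
Local Open Scope group_scope.

Definition has_identity (S : semigroupType) : Prop :=
  exists e : S, forall s : S, e * s = s /\ s * e = s.

Definition adjoin_one (S : semigroupType) : Type := option S.

HB.instance Definition _ (S : semigroupType) := Choice.on (adjoin_one S).

(* [None] is the new identity. *)
Definition adjoin_one_mul (S : semigroupType) (a b : adjoin_one S) :
    adjoin_one S :=
  match a, b with
  | None, _ => b
  | _, None => a
  | Some s, Some t => Some (s * t)
  end.

Fact adjoin_one_mulA (S : semigroupType) : associative (@adjoin_one_mul S).
Proof. by move=> [a|] [b|] [c|] //=; rewrite mulgA. Qed.

HB.instance Definition _ (S : semigroupType) :=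
  isSemigroup.Build (adjoin_one S) (@adjoin_one_mulA S).

Definition semigroup1 (S : semigroupType) : semigroupType :=
  if `[< has_identity S >] then S else adjoin_one S.

Definition klawe_condition (T : semigroupType) : Prop :=
  forall s x y : T, s * x = s * y -> exists t : T, x * t = y * t.

Definition right_ideal (S : semigroupType) (I : set S) : Prop :=
  I !=set0 /\ (forall i s : S, I i -> I (i * s)).

Definition left_reversible (S : semigroupType) : Prop :=
  ~ exists I J : set S, [/\ right_ideal I, right_ideal J & I `&` J = set0].

Local Open Scope ring_scope.

Definition left_amenable (R : realType) (S : semigroupType) : Prop :=
  exists mu : set S -> R,
    [/\ forall Y, 0 <= mu Y,
        mu [set: S] = 1,
        forall Y Z, Y `&` Z = set0 -> mu (Y `|` Z) = mu Y + mu Z &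
        forall (a : S) (Y : set S), mu [set s | Y (a * s)%g] = mu Y].

End SemigroupNotions.

Definition surjective_morphism (S T : semigroupType)
    (phi : {multiplicative S -> T}) : Prop :=
  forall t : T, exists s : S, phi s = t.

Section Cogrowth.
Variables (S : semigroupType) (X : finType).
Variable phi : {multiplicative free_semigroup X -> S}.

Definition equal_pairs (n : nat) : set (free_semigroup X * free_semigroup X) :=
  [set p | (word_length p.1 + word_length p.2)%N = n /\ phi p.1 = phi p.2].

(* Hence [fset_set] below enumerates exactly [equal_pairs n]; it would be
   empty on an infinite set. *)
Lemma finite_equal_pairs n : finite_set (equal_pairs n).
Proof.
pose E := [set w : free_semigroup X | (word_length w <= n)%N].
have finE : finite_set E.
  have inj : {in E &, injective (fun w : free_semigroup X => val w)}.
    by move=> u v _ _; apply: val_inj.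
  rewrite -(eq_finite_set (inj_card_eq inj)).
  apply: (@sub_finite_set _ _
    (\bigcup_(k in `I_n.+1) range (fun t : k.-tuple X => val t))).
    move=> _ [w wn <-]; exists (word_length w); first by rewrite /= ltnS.
    by exists (in_tuple (val w)).
  by apply: bigcup_finite => [|k _]; [exact: finite_II | exact: finite_image].
apply: (@sub_finite_set _ _ (E `*` E)); last exact: finite_setX.
by move=> [u v] [/= uvn _]; split; rewrite /E /= -uvn ?leq_addr ?leq_addl.
Qed.

Definition cogrowth (n : nat) : nat := #|` fset_set (equal_pairs n)|%N.

Local Open Scope ring_scope.

(* The limit superior is taken in the extended reals, where it always
   exists. *)
Definition cogrowth_rate (R : realType) : \bar R :=
  limn_esup (fun n : nat => ((cogrowth n)%:R `^ (n%:R^-1))%:E).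

Definition maximal_cogrowth (R : realType) : Prop :=
  cogrowth_rate R = (#|X|%:R)%:E.

End Cogrowth.

(* Main.v *)
Require Import Defs.
From mathcomp Require Import all_boot all_order all_algebra.
From mathcomp Require Import finmap.
From mathcomp Require Import all_classical all_reals all_analysis.
From mathcomp Require Import ring lra.

(** Write [r] for the number of generators and call two words [u], [v] stably
    equal if [u t = v t] in [S] for some [t]. Left reversibility provides
    common right multiples, so finitely many stable equalities can be realised
    by a single [t] (common_tail); hence stable equality is an equivalence, and
    the Klawe condition makes it left cancellative (stably_equal_cat). In other
    words [S] has a left cancellative quotient on which every word acts by an
    injective left translation, and anything finite in that quotient can be
    read off inside [S] after right multiplication by a suitable [t].

    Let [f_j] be the number of words of length [j] representing each element
    of the quotient, seen as a vector in l^2, and let [a_j] be its squared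
    norm, that is, the number of stably equal pairs of words of length [j].
    Then [f_(k+j)] is the sum of the [r^k] translates of [f_j] by words of
    length [k], all of norm [sqrt a_j]. A pair counted by the global cogrowth
    function contributes to an inner product [<f_i, f_(n-i)>]. If, for some
    [k], the ratio [a_(k+j) / a_j] stayed away from its maximum [r^(2k)], then
    [a_j / r^(2j)] would decay geometrically, and by Cauchy-Schwarz the global
    cogrowth rate would be less than [r] (overlap_growth). So under maximal
    cogrowth there are [j] for which the translates of [f_j] by words of length
    [k] add up to a vector of almost maximal norm, which forces any two of them
    to be almost equal (overlap_translates_ge).

    Consequently the probability [p] proportional to [f_j^2] satisfies: [w p]
    and [w' p] are close in total variation whenever [w], [w'] have the same
    length at most [k] (exists_almost_invariant_mass). For a fixed generator
    [x], the average [P] of [x^i p] over [i < k] is then almost invariant: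
    [y x^i p] is close to [x^(i+1) p] for every generator [y], so [y P] is
    close to the average of the [x^(i+1) p], which differs from [P] by only
    two terms out of [k] (exists_almost_invariant_mean). An ultrafilter limit
    of such means is the required measure (left_amenable_of_almost_invariant).
*)

Set Implicit Arguments.
Unset Strict Implicit.
Unset Printing Implicit Defensive.
Import Order.TTheory GRing.Theory Num.Theory.
Import numFieldNormedType.Exports.
Local Open Scope classical_set_scope.
Local Open Scope ring_scope.

(** * Correlations of finite multisets *)

Section Pairing.
Variables (R : realType) (T : eqType).
Implicit Types (U V : seq T) (F : T -> R).

(** The inner product, weighted by [F], of the multiplicity functions of two
    finite multisets. As a double sum it involves no enumeration of the
    support. *)
Definition pairing F U V : R :=
  \sum_(u <- U) \sum_(v <- V) (u == v)%:R * F u.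

Let mult U (s : T) : R := (count_mem s U)%:R.

Lemma multE U s : mult U s = \sum_(u <- U) (u == s)%:R.
Proof. by rewrite /mult -sum1_count natr_sum big_mkcond /=; apply: eq_bigr => u _; case: eqP. Qed.

(** Grouping the equal entries by their common value turns the double sum into
    a genuine inner product over the support. *)
Lemma pairingE F U V D : uniq D -> {subset U <= D} ->
  pairing F U V = \sum_(s <- D) mult U s * mult V s * F s.
Proof.
move=> uD sUD; rewrite /pairing.
transitivity (\sum_(u <- U) \sum_(s <- D) (u == s)%:R * (mult V s * F s)).
  rewrite big_seq [RHS]big_seq; apply: eq_bigr => u /sUD Du.
  rewrite [RHS](bigD1_seq u) //= eqxx mul1r [X in _ + X]big1 ?addr0 => [|s /negPf su].
    by rewrite multE mulr_suml; apply: eq_bigr => v _; rewrite eq_sym.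
  by rewrite eq_sym su mul0r.
rewrite exchange_big; apply: eq_bigr => s _.
by rewrite -mulr_suml -multE mulrA.
Qed.

(** Cauchy-Schwarz in the form [2 f g <= p f^2 + g^2 / p], which avoids square
    roots; the free weight [p] serves to balance two vectors of very different
    norms. *)
Lemma pairing_le U V (p : R) : 0 < p ->
  pairing (fun=> 1) U V
  <= (p * pairing (fun=> 1) U U + p^-1 * pairing (fun=> 1) V V) / 2.
Proof.
move=> p0; pose D := undup (U ++ V).
have uD : uniq D by exact: undup_uniq.
have UD : {subset U <= D} by move=> x xU; rewrite mem_undup mem_cat xU.
have VD : {subset V <= D} by move=> x xV; rewrite mem_undup mem_cat xV orbT.
rewrite (pairingE _ _ uD UD) (pairingE _ _ uD UD) (pairingE _ _ uD VD).
rewrite !mulr_sumr -big_split /= mulr_suml; apply: ler_sum => s _.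
move: (mult U s) (mult V s) => a b; rewrite !mulr1.
rewrite -subr_ge0.
have -> : (p * (a * a) + p^-1 * (b * b)) / 2 - a * b = (p * a - b) ^+ 2 / (2 * p).
  by field; rewrite gt_eqF.
by rewrite divr_ge0 ?sqr_ge0 // mulr_ge0 // ltW.
Qed.

(** Two vectors of equal norm that are almost parallel have nearby squares in
    l^1, because [|f^2 - g^2| = |f - g| (f + g)] and [|f - g|^2] has total mass
    [2 (a - <f, g>) <= 2 eta^2 a]. The weighted inequality
    [x y <= (x^2 / eta + eta y^2) / 2] balances the two factors. *)
Lemma pairing_dist F U V (a eta : R) : 0 < eta ->
  (forall s, 0 <= F s <= 1) ->
  pairing (fun=> 1) U U = a -> pairing (fun=> 1) V V = a ->
  (1 - eta ^+ 2) * a <= pairing (fun=> 1) U V ->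
  `|pairing F U U - pairing F V V| <= 3 * eta * a.
Proof.
move=> eta0 F01; pose D := undup (U ++ V).
have uD : uniq D by exact: undup_uniq.
have UD : {subset U <= D} by move=> x xU; rewrite mem_undup mem_cat xU.
have VD : {subset V <= D} by move=> x xV; rewrite mem_undup mem_cat xV orbT.
rewrite !(pairingE _ _ uD UD) !(pairingE _ _ uD VD).
set f := mult U; set g := mult V => fa ga ab.
rewrite -sumrB; apply: le_trans (ler_norm_sum _ _ _) _.
apply: (@le_trans _ _ (\sum_(s <- D)
   ((f s - g s) ^+ 2 / eta + eta * (f s + g s) ^+ 2) / 2)).
  apply: ler_sum => s _; have := F01 s; move: (F s) => c /andP[c0 c1].
  rewrite -mulrBl normrM (ger0_norm c0).
  apply: (@le_trans _ _ `|f s * f s - g s * g s|).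
    by rewrite ler_piMr.
  have -> : f s * f s - g s * g s = (f s - g s) * (f s + g s) by ring.
  rewrite normrM -[(f s - g s) ^+ 2]real_normK ?num_real //.
  rewrite -[(f s + g s) ^+ 2]real_normK ?num_real //.
  move: `|f s - g s| `|f s + g s| => x y; rewrite -subr_ge0.
  have -> : (x ^+ 2 / eta + eta * y ^+ 2) / 2 - x * y
     = (x - eta * y) ^+ 2 / (2 * eta) by field; rewrite gt_eqF.
  by rewrite divr_ge0 ?sqr_ge0 // mulr_ge0 // ltW.
set b := (X in _ <= X) in ab.
have -> : \sum_(s <- D) ((f s - g s) ^+ 2 / eta + eta * (f s + g s) ^+ 2) / 2
   = (a - b) / eta + eta * (a + b).
  rewrite -[a in a - b](_ : (a + a) / 2 = _); last by field.
  rewrite -[a in a + b](_ : (a + a) / 2 = _); last by field.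
  rewrite -{1 3}fa -ga /b !(mulrDl, mulrDr) -!sumrN !(mulr_suml, mulr_sumr) -!big_split /=.
  by apply: eq_bigr => s _; field; rewrite gt_eqF.
have ba : b <= a.
  have := pairing_le U V ltr01.
  by rewrite !(pairingE _ _ uD UD) !(pairingE _ _ uD VD) fa ga invr1 -/b; lra.
have h1 : (a - b) / eta <= eta * a.
  by rewrite ler_pdivrMr //; move: ab; rewrite -/b; nra.
have : eta * b <= eta * a by rewrite ler_pM2l.
lra.
Qed.
End Pairing.

(** * Words acting on the semigroup, and stable equality *)

(** Lists, rather than tuples, so that splitting a word of length [m + n]
    needs no transport between index types. *)
Fixpoint words (X : finType) n : seq (seq X) :=
  if n is m.+1 then [seq x :: w | x <- enum X, w <- words X m] else [:: [::]].

Section Words.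
Variable X : finType.

Lemma mem_words n (w : seq X) : (w \in words X n) = (size w == n).
Proof.
elim: n w => [|n IHn] [|x w] //=.
  by apply/allpairsP => -[[y v] [_ _]].
rewrite eqSS -IHn; apply/allpairsP/idP => [[[y v] [_ wv [_ ->]]] //|wn].
by exists (x, w); rewrite mem_enum.
Qed.

Lemma size_words n : size (words X n) = (#|X| ^ n)%N.
Proof. by elim: n => //= n IHn; rewrite size_allpairs IHn -cardE expnS. Qed.

Lemma big_words_add (V : nmodType) m n (F : seq X -> V) :
  \sum_(w <- words X (m + n)) F w
  = \sum_(u <- words X m) \sum_(v <- words X n) F (u ++ v).
Proof.
elim: m F => [|m IHm] F; first by rewrite /= big_seq1.
by rewrite /= !big_allpairs_dep; apply: eq_bigr => x _; rewrite IHm.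
Qed.

End Words.

Section Action.
Variables (S : semigroupType) (X : finType).
Variable phi : {multiplicative free_semigroup X -> S}.
Implicit Types (u v w : seq X) (s t : S).

Definition letter (x : X) : free_semigroup X := exist _ [:: x] isT.

(** The empty word acts as the identity although [S] may have none. *)
Definition act w s : S := foldr (fun x s => (phi (letter x) * s)%g) s w.

Lemma act_cat u v s : act (u ++ v) s = act u (act v s).
Proof. exact: foldr_cat. Qed.

Lemma actM u s t : (act u s * t)%g = act u (s * t)%g.
Proof. by elim: u => //= x u <-; rewrite mulgA. Qed.

Lemma act_word (w : free_semigroup X) s : act (val w) s = (phi w * s)%g.
Proof.
case: w => w w0 /=; elim: w w0 => // x [|y w] IHw w0 /=.
  by congr (phi _ * _)%g; exact: val_inj.
move/(_ isT): IHw => /= ->; rewrite mulgA -gmulfM.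
by congr (phi _ * _)%g; exact: val_inj.
Qed.

(** For a left reversible [S], equality in the largest right cancellative
    quotient of [S]. *)
Definition stably_equal u v := exists t, act u t = act v t.

(** The principal right ideals of [a] and [b] would otherwise be disjoint. *)
Lemma left_reversible_mul : left_reversible S ->
  forall a b : S, exists c d, (a * c = b * d)%g.
Proof.
move=> rev a b; apply: contrapT => nex; apply: rev.
exists [set s | exists c, s = (a * c)%g], [set s | exists c, s = (b * c)%g].
split.
- split; first by exists (a * a)%g, a.
  by move=> _ s [c ->]; exists (c * s)%g; rewrite mulgA.
- split; first by exists (b * b)%g, b.
  by move=> _ s [c ->]; exists (c * s)%g; rewrite mulgA.
- rewrite -subset0 => s [[c ->] [d e]]; apply: nex.
  by exists c, d.
Qed.

(** If the witness is an adjoined identity then [x = y], and any element of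
    [S] will do. *)
Lemma klawe_mul : klawe_condition (semigroup1 S) ->
  forall s x y : S, (s * x = s * y)%g -> exists t, (x * t = y * t)%g.
Proof.
rewrite /semigroup1; case: ifP => _ K s x y sxy; first exact: K sxy.
have [|[t|] [e]] := K (Some s) (Some x) (Some y); last by exists x; rewrite e.
  by change (Some (s * x)%g = Some (s * y)%g); rewrite sxy.
by exists t.
Qed.

Hypothesis hS : inhabited S.
Hypothesis hrev : left_reversible S.
Hypothesis hklawe : klawe_condition (semigroup1 S).

Lemma stably_equal_cons x u v :
  stably_equal (x :: u) (x :: v) <-> stably_equal u v.
Proof.
split=> -[t e]; last by exists t; rewrite /= e.
have [s] := klawe_mul hklawe e.
by rewrite !actM; exists (t * s)%g.
Qed.

Lemma stably_equal_cat w u v :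
  stably_equal (w ++ u) (w ++ v) <-> stably_equal u v.
Proof.
by elim: w => //= x w <-; exact: stably_equal_cons.
Qed.

Lemma stably_equal_refl u : stably_equal u u.
Proof. by case: hS => s; exists s. Qed.

(** Stable equality by means of [t] persists for all right multiples of [t],
    so two witnesses can be merged into a common right multiple. *)
Lemma common_tail_pairs (L : seq (seq X * seq X)) :
  exists t, forall u v, (u, v) \in L -> stably_equal u v -> act u t = act v t.
Proof.
elim: L => [|[u v] L [t IHt]]; first by case: hS => s; exists s.
have [[t' e]|nuv] := pselect (stably_equal u v).
  have [c [d cd]] := left_reversible_mul hrev t t'.
  exists (t * c)%g => u' v'; rewrite inE => /predU1P[[-> ->] _|L' uv'].
    by rewrite cd -!actM e.
  by rewrite -!actM (IHt u' v').
exists t => u' v'; rewrite inE => /predU1P[[-> ->] /nuv //|]; exact: IHt.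
Qed.

(** On a finite set of words, stable equality becomes an actual equality of
    elements of [S]; this transfers l^2 estimates from the quotient to [S]. *)
Lemma common_tail (W : seq (seq X)) :
  exists t, {in W &, forall u v, stably_equal u v <-> act u t = act v t}.
Proof.
have [t Ht] := common_tail_pairs [seq (u, v) | u <- W, v <- W].
exists t => u v uW vW; split; last by exists t.
by apply: Ht; apply/allpairsP; exists (u, v).
Qed.

End Action.

(** * Elementary estimates on real sequences *)

Section RealSequences.
Variable R : realType.

Lemma root_below1 (c : R) m : (0 < m)%N -> c < 1 ->
  exists e : R, 0 < e < 1 /\ c <= e ^+ m.
Proof.
move=> m0 c1.
(* The maximum with 1/2 provides a positive base also when [c <= 0]. *)
pose b := Num.max c (2^-1).
have b0 : 0 < b by rewrite lt_max invr_gt0 ltr0n orbT.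
have b1 : b < 1 by rewrite gt_max c1 /= invf_lt1 // ltr1n.
exists (b `^ (m%:R^-1)); split; last first.
  rewrite -powR_mulrn ?powR_ge0 // -powRrM mulVf ?pnatr_eq0 -?lt0n //.
  by rewrite powRr1 ?(ltW b0) // le_max lexx.
rewrite powR_gt0 //=.
have := @gt0_ltr_powR R m%:R^-1; rewrite invr_gt0 ltr0n m0 => /(_ isT b 1).
by rewrite !nnegrE (ltW b0) ler01 powR1 => ->.
Qed.

(** The decay rate is delivered as an [m]-th power, which leaves room to give
    up some factors [e] later in exchange for polynomial and constant
    factors. *)
Lemma geometric_decay (alpha : nat -> R) k m (c : R) :
  (0 < k)%N -> (0 < m)%N -> c < 1 ->
  (forall j, 0 <= alpha j <= 1) -> (forall j, alpha (k + j)%N <= c * alpha j) ->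
  exists2 e : R, 0 < e < 1 &
    exists2 C : R, 0 < C & forall i, alpha i <= C * (e ^+ m) ^+ i.
Proof.
move=> k0 m0 c1 a01 rec.
have [|e [/andP[e0 e1] ce]] := @root_below1 c (m * k) _ c1.
  by rewrite muln_gt0 m0.
exists e; first by rewrite e0.
rewrite exprM in ce; move: (e ^+ m) ce (exprn_gt0 m e0)
  (exprn_ile1 m (ltW e0) (ltW e1)) => d cd d0 d1.
exists (d ^+ k)^-1; first by rewrite invr_gt0 exprn_gt0.
move=> i; have [n] := ubnP i; elim: n i => // n IHn i; rewrite ltnS => ile.
have [ik|ki] := ltnP i k.
  have /andP[_ /le_trans->//] := a01 i.
  by rewrite mulrC ler_pdivlMr ?exprn_gt0 // mul1r ler_wiXn2l ?(ltW d0) ?(ltnW ik).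
rewrite -(subnKC ki); apply: le_trans (rec _) _.
have /andP[ai0 _] := a01 (i - k)%N.
apply: le_trans (ler_wpM2r ai0 cd) _.
rewrite exprD mulrCA ler_pM2l ?exprn_gt0 //; apply: IHn.
by apply: leq_trans ile; rewrite ltn_subrL k0 (leq_trans k0 ki).
Qed.

(** [e^n] is the smallest of the first [n + 1] terms of the geometric
    series. *)
Lemma mulrn_expr_le (e : R) n : 0 < e < 1 -> n.+1%:R * e ^+ n <= (1 - e)^-1.
Proof.
move=> /andP[e0 e1]; rewrite -[X in _ <= X]mul1r ler_pdivlMr ?subr_gt0 //.
apply: (@le_trans _ _ (1 - e ^+ n.+1)); last first.
  by rewrite lerBlDr lerDl exprn_ge0 // ltW.
rewrite -[1 - e ^+ n.+1]opprB subrX1 -mulNr opprB mulrC ler_pM2l ?subr_gt0 //.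
have -> : n.+1%:R * e ^+ n = \sum_(i < n.+1) e ^+ n.
  by rewrite sumr_const card_ord mulr_natl.
by apply: ler_sum => i _; rewrite ler_wiXn2l ?(ltW e0) ?(ltW e1) // -ltnS.
Qed.

(** One of the two factors [e] absorbs the constant [K]. *)
Lemma limn_esup_root_le (g : nat -> nat) (r K e : R) :
  0 <= r -> 0 < K -> 0 < e < 1 ->
  (forall n, (g n)%:R <= K * (r * e ^+ 2) ^+ n) ->
  (limn_esup (fun n => ((g n)%:R `^ (n%:R^-1))%:E) <= (r * e)%:E)%E.
Proof.
move=> r0 K0 /andP[e0 e1] gle.
have : geometric K e x @[x --> \oo] --> (0 : R).
  by apply: cvg_geometric; rewrite gtr0_norm.
move=> /cvgrPdist_le /(_ 1 ltr01) [N _ HN].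
have reN n : (N.+1 <= n)%N -> (g n)%:R `^ (n%:R^-1) <= r * e.
  move=> Nn; have n0 : (0 < n)%N by exact: leq_trans Nn.
  have Ke : K * e ^+ n <= 1.
    have := HN n (ltnW Nn); rewrite /= sub0r normrN.
    by apply: le_trans; rewrite ler_norm.
  have re0 : 0 <= r * e by rewrite mulr_ge0 // ltW.
  have gn : (g n)%:R <= (r * e) ^+ n.
    apply: le_trans (gle n) _.
    rewrite expr2 mulrA (exprMn _ (r * e)) mulrCA -[X in _ <= X]mulr1.
    by rewrite ler_wpM2l // exprn_ge0.
  apply: (@le_trans _ _ (((r * e) ^+ n) `^ (n%:R^-1))).
    by apply: ge0_ler_powR => //; rewrite ?nnegrE ?invr_ge0 ?ler0n ?exprn_ge0.
  rewrite -powR_mulrn // -powRrM mulfV ?pnatr_eq0 -?lt0n //.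
  by rewrite powRr1.
apply: le_trans (ereal_inf_lbound _) _.
  by exists [set n | (N.+1 <= n)%N]; [exists N.+1 | reflexivity].
apply: ub_ereal_sup => _ [n Nn <-]; rewrite lee_fin; exact: reN.
Qed.

End RealSequences.

(** * Counting stably equal pairs of words *)

Section Overlap.
Variables (R : realType) (S : semigroupType) (X : finType).
Variable phi : {multiplicative free_semigroup X -> S}.
Implicit Types (u v w : seq X) (U V W : seq (seq X)).

Definition overlap U V : R :=
  \sum_(u <- U) \sum_(v <- V) `[< stably_equal phi u v >]%:R.

Lemma overlap_ge0 U V : 0 <= overlap U V.
Proof. by apply: sumr_ge0 => u _; apply: sumr_ge0. Qed.

Lemma overlap_le_size U V : overlap U V <= (size U * size V)%:R.
Proof.
have -> : (size U * size V)%:R = \sum_(u <- U) \sum_(v <- V) (1 : R).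
  rewrite -[1]/(1%:R); under eq_bigr do rewrite -natr_sum sum1_size.
  by rewrite -natr_sum big_const_seq count_predT iter_addn_0 mulnC.
by apply: ler_sum => u _; apply: ler_sum => v _; case: asbool; rewrite ?ler01.
Qed.

Definition translate w U := [seq w ++ u | u <- U].

(** The norm of a sum of translates expands into all inner products of two
    translates. *)
Lemma overlap_words_add k j :
  overlap (words X (k + j)) (words X (k + j))
  = \sum_(w <- words X k) \sum_(w' <- words X k)
      overlap (translate w (words X j)) (translate w' (words X j)).
Proof.
rewrite /overlap big_words_add; apply: eq_bigr => w _.
transitivity (\sum_(u <- words X j) \sum_(w' <- words X k)
    \sum_(v <- words X j) `[< stably_equal phi (w ++ u) (w' ++ v) >]%:R : R).
  by apply: eq_bigr => u _; rewrite big_words_add.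
rewrite exchange_big; apply: eq_bigr => w' _; rewrite big_map.
by apply: eq_bigr => u _; rewrite big_map.
Qed.

(** Inner products in the quotient can be computed inside [S]. *)
Lemma pairing_tail t W U V :
  {in W &, forall u v, stably_equal phi u v <-> act phi u t = act phi v t} ->
  {subset U <= W} -> {subset V <= W} ->
  pairing (fun=> 1) (map (act phi ^~ t) U) (map (act phi ^~ t) V) = overlap U V.
Proof.
move=> tW UW VW; rewrite /pairing /overlap big_map big_seq [RHS]big_seq.
apply: eq_bigr => u uU; rewrite big_map big_seq [RHS]big_seq.
apply: eq_bigr => v vV; rewrite mulr1; congr (nat_of_bool _)%:R.
by apply/eqP/asboolP => /(tW _ _ (UW _ uU) (VW _ vV)).
Qed.

Hypothesis hS : inhabited S.
Hypothesis hrev : left_reversible S.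
Hypothesis hklawe : klawe_condition (semigroup1 S).

Lemma overlap_self_gt0 U : (0 < size U)%N -> 0 < overlap U U.
Proof.
case: U => // u U _; rewrite /overlap big_cons ltr_wpDr //.
  by apply: sumr_ge0 => v _; apply: sumr_ge0.
rewrite big_cons ltr_wpDr //; first by apply: sumr_ge0.
by rewrite asboolT ?ltr01 //; exact: stably_equal_refl.
Qed.

Lemma overlap_le U V p : 0 < p ->
  overlap U V <= (p * overlap U U + p^-1 * overlap V V) / 2.
Proof.
have [t tW] := common_tail phi hS hrev (U ++ V).
have UW : {subset U <= U ++ V} by move=> u uU; rewrite mem_cat uU.
have VW : {subset V <= U ++ V} by move=> v vV; rewrite mem_cat vV orbT.
rewrite -(pairing_tail tW UW VW) -(pairing_tail tW UW UW) -(pairing_tail tW VW VW).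
exact: pairing_le.
Qed.

(** Left cancellation: translations are isometric. *)
Lemma overlap_translate w U :
  overlap (translate w U) (translate w U) = overlap U U.
Proof.
rewrite /overlap big_map; apply: eq_bigr => u _; rewrite big_map.
apply: eq_bigr => v _; congr (nat_of_bool _)%:R.
by apply: asbool_equiv_eq; exact: stably_equal_cat.
Qed.

Lemma overlap_translates_le w w' U :
  overlap (translate w U) (translate w' U) <= overlap U U.
Proof.
have := overlap_le (translate w U) (translate w' U) ltr01.
by rewrite !overlap_translate; lra.
Qed.

Lemma cogrowth_le n : (cogrowth phi n)%:R
  <= \sum_(i < n.+1) overlap (words X i) (words X (n - i)).
Proof.
pose P (p : seq X * seq X) := `[< stably_equal phi p.1 p.2 >].
pose L := flatten [seq [seq (u, v) | u <- words X i, v <- words X (n - i)]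
   | i <- iota 0 n.+1].
have -> : \sum_(i < n.+1) overlap (words X i) (words X (n - i))
    = (size [seq p <- L | P p])%:R.
  rewrite size_filter -sum1_count natr_sum [RHS]big_mkcond /= big_flatten big_map.
  rewrite -[iota 0 n.+1]/(index_iota 0 n.+1) big_mkord.
  apply: eq_bigr => i _; rewrite /overlap big_allpairs.
  by apply: eq_bigr => u _; apply: eq_bigr => v _; rewrite /P /=; case: asbool.
rewrite ler_nat.
pose g (p : free_semigroup X * free_semigroup X) := (val p.1, val p.2).
have g_inj : injective g by move=> [u v] [u' v'] [/val_inj -> /val_inj ->].
rewrite /cogrowth -(size_map g); apply: uniq_leq_size.
  by rewrite map_inj_uniq // fset_uniq.
move=> _ /mapP[[u v] uv ->]; move: uv.
rewrite in_fset_set; last exact: finite_equal_pairs.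
rewrite inE => -[/= uvn uv]; rewrite mem_filter; apply/andP; split.
  case: hS => s; apply/asboolP; exists s.
  by rewrite /= !act_word uv.
apply/flattenP; exists [seq (u', v') | u' <- words X (word_length u),
    v' <- words X (n - word_length u)].
  apply/mapP; exists (word_length u) => //.
  by rewrite mem_iota add0n ltnS -uvn leq_addr.
apply/allpairsP; exists (val u, val v); split => //; rewrite mem_words //.
by rewrite -uvn addKn.
Qed.

(** Otherwise [a_j / r^(2j)] is at most [C e^(6j)] for some [e < 1], so
    Cauchy-Schwarz bounds each of the [n + 1] inner products dominating the
    cogrowth function by [C (r e^3)^n]; the factor [n + 1] costs one [e], the
    constant another, and the cogrowth rate is at most [r e]. *)
Lemma overlap_growth (k : nat) (d : R) :
  (0 < #|X|)%N -> maximal_cogrowth phi R -> (0 < k)%N -> 0 < d ->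
  exists j, (#|X|%:R ^+ (k + k) - d) * overlap (words X j) (words X j)
    <= overlap (words X (k + j)) (words X (k + j)).
Proof.
set r := #|X|%:R => X0 hmax k0 d0; apply: contrapT => nex.
have r0 : 0 < r :> R by rewrite ltr0n.
pose a j := overlap (words X j) (words X j).
have aS j : a (k + j)%N <= (r ^+ (k + k) - d) * a j.
  by rewrite leNgt; apply/negP => /ltW ?; apply: nex; exists j.
pose alpha j := a j / r ^+ (j + j).
have [||||e e01 [C C0 aC]] :=
    @geometric_decay R alpha k 6 (1 - d / r ^+ (k + k)) k0.
- by [].
- by rewrite ltrBlDr ltrDl divr_gt0 // exprn_gt0.
- move=> j; rewrite divr_ge0 ?overlap_ge0 ?exprn_ge0 ?(ltW r0) //=.
  rewrite ler_pdivrMr ?exprn_gt0 // mul1r.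
  by apply: le_trans (overlap_le_size _ _) _; rewrite !size_words natrM !natrX exprD.
- move=> j; rewrite /alpha ler_pdivrMr ?exprn_gt0 //.
  apply: le_trans (aS j) _; rewrite le_eqVlt; apply/orP; left; apply/eqP.
  by rewrite /a !exprD; field; rewrite !expf_neq0 ?gt_eqF.
have [e0 e1] := andP e01.
pose q := r * e ^+ 3.
have q0 : 0 < q by rewrite mulr_gt0 // exprn_gt0.
have aq i : a i <= C * q ^+ (i + i).
  have := aC i; rewrite /alpha ler_pdivrMr ?exprn_gt0 // => /le_trans; apply.
  rewrite le_eqVlt; apply/orP; left; apply/eqP.
  rewrite /q (exprMn _ r) -!exprM -mulrA [_ * r ^+ _]mulrC.
  by congr (_ * (_ * _ ^+ _)); rewrite addnn -mul2n mulnA.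
have oq i j : overlap (words X i) (words X j) <= C * q ^+ (i + j).
  (* This weight turns both [C q^(2i)] and [C q^(2j)] into [C q^(i+j)]. *)
  apply: le_trans (overlap_le _ _ (_ : 0 < q ^+ j / q ^+ i)) _.
    by rewrite divr_gt0 ?exprn_gt0.
  rewrite ler_pdivrMr // invf_div.
  apply: (@le_trans _ _ (q ^+ j / q ^+ i * (C * q ^+ (i + i)) +
      q ^+ i / q ^+ j * (C * q ^+ (j + j)))).
    by rewrite lerD // ler_wpM2l ?aq // divr_ge0 // exprn_ge0 // ltW.
  rewrite le_eqVlt; apply/orP; left; apply/eqP.
  by rewrite !exprD; field; rewrite !expf_neq0 ?gt_eqF.
have e1' : 0 < (1 - e)^-1 by rewrite invr_gt0 subr_gt0.
have := @limn_esup_root_le R (cogrowth phi) r (C / (1 - e)) e (ltW r0).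
move=> /(_ (mulr_gt0 C0 e1') e01).
move: hmax; rewrite /maximal_cogrowth /cogrowth_rate => ->.
rewrite lee_fin => H; have : r <= r * e.
  apply: H => n; apply: le_trans (cogrowth_le n) _.
  apply: (@le_trans _ _ (\sum_(i < n.+1) C * q ^+ n)).
    apply: ler_sum => i _; apply: le_trans (oq _ _) _.
    by rewrite subnKC // -ltnS.
  rewrite sumr_const card_ord -[_ *+ _]mulr_natl.
  have -> : n.+1%:R * (C * q ^+ n) = (n.+1%:R * e ^+ n) * (C * (r * e ^+ 2) ^+ n).
    by rewrite /q exprS mulrA mulrC !exprMn; ring.
  rewrite [leRHS](_ : _ = (1 - e)^-1 * (C * (r * e ^+ 2) ^+ n)); last by ring.
  rewrite ler_wpM2r ?mulrn_expr_le //.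
  by rewrite mulr_ge0 ?exprn_ge0 // ?mulr_ge0 ?exprn_ge0 // ltW.
by rewrite ler_pMr // leNgt e1.
Qed.

(** The [r^(2k)] inner products of translates are each at most [a_j] and add up
    to at least [(r^(2k) - d) a_j], so none of them falls short of [a_j] by more
    than [d a_j]. *)
Lemma overlap_translates_ge (k : nat) (d : R) :
  (0 < #|X|)%N -> maximal_cogrowth phi R -> (0 < k)%N -> 0 < d ->
  exists j, {in words X k &, forall w w',
    (1 - d) * overlap (words X j) (words X j)
    <= overlap (translate w (words X j)) (translate w' (words X j))}.
Proof.
move=> X0 hmax k0 d0; have [j] := overlap_growth X0 hmax k0 d0.
set a := overlap (words X j) _ => aj; exists j => w w' wk wk'.
pose L := [seq (v, v') | v <- words X k, v' <- words X k].
pose B p := overlap (translate p.1 (words X j)) (translate p.2 (words X j)).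
have sL : (size L)%:R = #|X|%:R ^+ (k + k) :> R.
  by rewrite size_allpairs !size_words natrM natrX exprD.
have L0 : (w, w') \in L by apply/allpairsP; exists (w, w').
move: aj; rewrite overlap_words_add (_ : \sum_(v <- _) _ = \sum_(p <- L) B p).
  2: by rewrite big_allpairs.
rewrite (big_rem _ L0) /=.
have : \sum_(p <- rem (w, w') L) B p <= \sum_(p <- rem (w, w') L) a.
  by apply: ler_sum => p _; exact: overlap_translates_le.
have -> : \sum_(p <- rem (w, w') L) a = (#|X|%:R ^+ (k + k) - 1) * a.
  rewrite big_const_seq count_predT iter_addr_0 size_rem // -[a *+ _]mulr_natl.
  by rewrite -subn1 natrB ?sL //; case: (L) L0.
rewrite -/a -/(B (w, w')); move: (B _) (\sum_(p <- _) B p) => b s; lra.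
Qed.

End Overlap.

(** * Almost invariant means *)

Definition finitely_additive_probability (R : realType) (T : Type)
    (m : set T -> R) :=
  [/\ forall Y, 0 <= m Y, m setT = 1 &
      forall Y Z, Y `&` Z = set0 -> m (Y `|` Z) = m Y + m Z].

Section Means.
Variables (R : realType) (S : semigroupType) (X : finType).
Variable phi : {multiplicative free_semigroup X -> S}.
Hypothesis hS : inhabited S.
Hypothesis hrev : left_reversible S.
Hypothesis hklawe : klawe_condition (semigroup1 S).

(** The measure on [S] giving to a point the square of its multiplicity in
    [U], pushed forward along the action of [w]; its total mass is the squared
    norm of [U]. *)
Definition translate_mass (U : seq S) (w : seq X) (Y : set S) : R :=
  pairing (fun s => \1_Y (act phi w s)) U U.

Definition mean (U : seq S) (x : X) k (Y : set S) : R :=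
  (\sum_(i < k) translate_mass U (nseq i x) Y)
  / (k%:R * pairing (fun=> 1) U U).

Lemma mean_probability U x k : (0 < k)%N -> 0 < pairing (fun=> 1 : R) U U ->
  finitely_additive_probability (mean U x k).
Proof.
move=> k0 U0; have kU0 : 0 < k%:R * pairing (fun=> 1 : R) U U.
  by rewrite mulr_gt0 // ltr0n.
split=> [Y||Y Z YZ].
- rewrite divr_ge0 ?(ltW kU0) //; do 3![apply: sumr_ge0 => ? _].
  by rewrite mulr_ge0.
- rewrite /mean (eq_bigr (fun=> pairing (fun=> 1 : R) U U)) => [|i _].
    by rewrite sumr_const card_ord -[pairing _ _ _ *+ _]mulr_natl divff // gt_eqF.
  by rewrite /translate_mass indicT.
- rewrite /mean -mulrDl -big_split /=; congr (_ / _); apply: eq_bigr => i _.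
  rewrite /translate_mass /pairing -big_split /=; apply: eq_bigr => u _.
  rewrite -big_split /=; apply: eq_bigr => v _; rewrite -mulrDr; congr (_ * _).
  rewrite !indicE in_setU; case: (boolP (_ \in Y)) => [|_]; last by rewrite add0r.
  case: (boolP (_ \in Z)) => [|_ _]; last by rewrite addr0.
  rewrite !inE => Zs Ys; suff : (Y `&` Z) (act phi (nseq i x) u) by rewrite YZ.
  by split.
Qed.

(** [U] lists the elements [u t] for the words [u] of a well chosen length [j].
    The tail [t] is common to all words of length at most [k + j], so that
    translating [U] by a word of length at most [k] is injective on the values
    of [U]. *)
Lemma exists_almost_invariant_mass k (eta : R) :
  (0 < #|X|)%N -> maximal_cogrowth phi R -> (0 < k)%N -> 0 < eta ->
  exists2 U : seq S, 0 < pairing (fun=> 1 : R) U U &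
    forall w w' Y, size w = size w' -> (size w <= k)%N ->
      `|translate_mass U w Y - translate_mass U w' Y|
      <= 3 * eta * pairing (fun=> 1) U U.
Proof.
move=> X0 hmax k0 eta0.
have [j Hj] :=
  overlap_translates_ge hS hrev hklawe X0 hmax k0 (exprn_gt0 2 eta0).
pose W := flatten [seq words X i | i <- iota 0 (k + j).+1].
have memW u : (size u <= k + j)%N -> u \in W.
  move=> uk; apply/flattenP; exists (words X (size u)); last first.
    by rewrite mem_words.
  by apply/mapP; exists (size u) => //; rewrite mem_iota ltnS.
have [t tW] := common_tail phi hS hrev W.
pose U w := map (act phi ^~ t) (translate w (words X j)).
have subW w : (size w <= k)%N -> {subset translate w (words X j) <= W}.
  move=> wk _ /mapP[u + ->]; rewrite mem_words => /eqP uj.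
  by apply: memW; rewrite size_cat uj leq_add2r.
have UUE w : (size w <= k)%N ->
    pairing (fun=> 1) (U w) (U w) = overlap R phi (words X j) (words X j).
  move=> wk; rewrite /U (pairing_tail _ tW (subW _ wk) (subW _ wk)).
  exact: overlap_translate.
exists (U [::]).
  rewrite UUE //; apply: overlap_self_gt0 => //.
  by rewrite size_words expn_gt0 X0.
have massE w Y : (size w <= k)%N ->
    translate_mass (U [::]) w Y = pairing \1_Y (U w) (U w).
  move=> wk; rewrite /translate_mass /pairing /U !big_map.
  rewrite big_seq [RHS]big_seq; apply: eq_bigr => u uj; rewrite !big_map.
  rewrite big_seq [RHS]big_seq; apply: eq_bigr => v vj; rewrite -act_cat.
  congr (_%:R * _); congr nat_of_bool.
  have inW z s : (size z <= k)%N -> s \in words X j -> z ++ s \in W.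
    by move=> zk sj; apply: (subW z) => //; apply/mapP; exists s.
  apply/eqP/eqP.
    move=> /(tW _ _ (inW [::] _ isT uj) (inW [::] _ isT vj)) uv.
    apply/(tW _ _ (inW w _ wk uj) (inW w _ wk vj)).
    exact/stably_equal_cat.
  move=> /(tW _ _ (inW w _ wk uj) (inW w _ wk vj)) uv.
  apply/(tW _ _ (inW [::] _ isT uj) (inW [::] _ isT vj)).
  by have /(_ hklawe w u v)[/(_ uv)] := @stably_equal_cat _ _ phi.
move=> w w' Y ww' wk; have w'k : (size w' <= k)%N by rewrite -ww'.
rewrite !massE // UUE //; apply: pairing_dist => //; rewrite ?UUE //.
  by move=> s; rewrite indicE; case: (s \in Y); rewrite ?lexx ?ler01.
(* Left cancellation allows both words to be padded on the left to length
   [k], where the estimate on inner products of translates applies. *)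
have /card_gt0P[x _] := X0.
pose z := nseq (k - size w) x.
have := Hj (z ++ w) (z ++ w').
rewrite !mem_words !size_cat size_nseq -ww' subnK // eqxx => /(_ isT isT).
rewrite /U (pairing_tail _ tW (subW _ wk) (subW _ w'k)) => /le_trans; apply.
rewrite le_eqVlt; apply/orP; left; apply/eqP.
rewrite /overlap /translate !big_map; apply: eq_bigr => u _; rewrite !big_map.
apply: eq_bigr => v _; congr (nat_of_bool _)%:R.
by apply: asbool_equiv_eq; rewrite -!catA; exact: stably_equal_cat.
Qed.

Lemma exists_almost_invariant_mean (eps : R) :
  (0 < #|X|)%N -> maximal_cogrowth phi R -> 0 < eps ->
  exists2 m : set S -> R, finitely_additive_probability m &
    forall x Y, `|m [set s | Y (phi (letter x) * s)%g] - m Y| <= eps.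
Proof.
move=> X0 hmax eps0; have /card_gt0P[x0 _] := X0.
pose k := (Num.truncn (2 / eps)).+1.
have k0 : 0 < k%:R :> R by rewrite ltr0n.
have [||U U0 HU] := @exists_almost_invariant_mass k (eps / 6) X0 hmax.
- by [].
- by rewrite divr_gt0.
exists (mean U x0 k); first exact: mean_probability.
move=> x Y; rewrite /mean -mulrBl normrM.
have kU0 : 0 < k%:R * pairing (fun=> 1 : R) U U by rewrite mulr_gt0.
rewrite normfV (gtr0_norm kU0) ler_pdivrMr //.
pose f i := translate_mass U (nseq i x0) Y.
(* Preimages under [x] and pushforwards match: the set pulled back along
   [x] has, after [x0^i], the mass of the original set after [x x0^i]. *)
rewrite (eq_bigr (fun i : 'I_k => translate_mass U (x :: nseq i x0) Y)) => [|i _].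
  2: congr pairing; apply/funext => s /=; rewrite !indicE.
have -> : \sum_(i < k) translate_mass U (x :: nseq i x0) Y - \sum_(i < k) f i
  = \sum_(i < k) (translate_mass U (x :: nseq i x0) Y - f i.+1) + (f k - f 0%N).
  rewrite -(telescope_sumr f (leq0n k)) big_mkord -big_split /= -sumrB.
  by apply: eq_bigr => i _; ring.
apply: le_trans (ler_normD _ _) _.
have h1 : `|\sum_(i < k) (translate_mass U (x :: nseq i x0) Y - f i.+1)|
   <= k%:R * (eps / 2 * pairing (fun=> 1) U U).
  apply: le_trans (ler_norm_sum _ _ _) _.
  have <- : \sum_(i < k) eps / 2 * pairing (fun=> 1) U U
      = k%:R * (eps / 2 * pairing (fun=> 1) U U).
    by rewrite sumr_const card_ord mulr_natl.
  apply: ler_sum => i _.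
  have -> : eps / 2 = 3 * (eps / 6) by field.
  by apply: HU; rewrite /= ?size_nseq.
have f01 i : 0 <= f i <= pairing (fun=> 1) U U.
  apply/andP; split; first by do 2![apply: sumr_ge0 => ? _]; rewrite mulr_ge0.
  by do 2![apply: ler_sum => ? _]; rewrite ler_wpM2l // indicE.
have h2 : `|f k - f 0%N| <= pairing (fun=> 1) U U.
  have /andP[? ?] := f01 k; have /andP[? ?] := f01 0%N.
  by rewrite ler_norml; apply/andP; split; lra.
have h3 : 1 <= k%:R * (eps / 2).
  have : 2 / eps < k%:R by exact: truncnS_gt.
  by rewrite ltr_pdivrMr //; lra.
have := ler_wpM2r (ltW U0) h3.
lra.
Qed.

End Means.

(** The image ultrafilter clusters at some point of the compact unit interval,
    and an ultrafilter converges to each of its cluster points. *)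
Lemma ultrafilter_bounded_cvg (R : realType) (I : Type) (G : set_system I)
    (u : I -> R) : UltraFilter G -> (forall i, 0 <= u i <= 1) ->
  exists l : R, u @ G --> l.
Proof.
move=> uG u01.
have [|l [_ lu]] := @segment_compact R 0 1 (u @ G) _.
  by apply: (@filterE _ G) => i; rewrite /= in_itv /= u01.
exists l => V Vl.
have [//|nV] := in_ultra_setVsetC (u @^-1` V) uG.
by have [y [/= ? ?]] := lu (~` V) V nV Vl.
Qed.

Lemma left_amenable_of_almost_invariant (R : realType) (S : semigroupType)
    (X : finType) (phi : {multiplicative free_semigroup X -> S}) :
  surjective_morphism phi ->
  (forall eps : R, 0 < eps ->
   exists2 m : set S -> R, finitely_additive_probability m &
     forall x Y, `|m [set s | Y (phi (letter x) * s)%g] - m Y| <= eps) ->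
  left_amenable R S.
Proof.
move=> hphi almost.
have /choice[m Hm] : forall n : nat, exists m : set S -> R,
    finitely_additive_probability m /\
    forall x Y, `|m [set s | Y (phi (letter x) * s)%g] - m Y| <= n.+1%:R^-1.
  move=> n; have [|m mP mI] := almost n.+1%:R^-1; first by rewrite invr_gt0.
  by exists m.
have [G [uG ooG]] := @ultraFilterLemma nat \oo _.
have m01 Y n : 0 <= m n Y <= 1.
  have [[m0 m1 mU] _] := Hm n; rewrite m0 /= -m1 -(setUv Y) mU ?setICr //.
  by rewrite lerDl.
have /choice[mu muP] : forall Y, exists l : R, m n Y @[n --> G] --> l.
  by move=> Y; exact: ultrafilter_bounded_cvg.
have muI x Y : mu [set s | Y (phi (letter x) * s)%g] = mu Y.
  apply/eqP; rewrite -subr_eq0; apply/eqP.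
  apply: (@norm_cvg_unique _ _ ((m n [set s | Y (phi (letter x) * s)%g] - m n Y) @[n --> G])).
    exact: cvgB.
  apply: (@cvg_trans _ ((m n [set s | Y (phi (letter x) * s)%g] - m n Y) @[n --> \oo])).
    by move=> V; exact: ooG.
  apply: (@squeeze_cvgr _ _ _ _ (fun n => - n.+1%:R^-1) (fun n => n.+1%:R^-1)).
  - by apply: nearW => n; rewrite -ler_norml; case: (Hm n).
  - by rewrite -[0]oppr0; apply: cvgN; exact: cvg_harmonic.
  - exact: cvg_harmonic.
exists mu; split=> [Y||Y Z YZ|a Y].
- by apply: cvgr_to_ge (muP Y) _; apply: nearW => n; case/andP: (m01 Y n).
- apply: (@norm_cvg_unique _ _ (m n setT @[n --> G])); first exact: muP.
  rewrite (_ : (fun n => m n setT) = fun=> 1); first exact: cvg_cst.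
  by apply/funext => n; have [[]] := Hm n.
- apply: (@norm_cvg_unique _ _ (m n (Y `|` Z) @[n --> G])); first exact: muP.
  rewrite (_ : (fun n => m n (Y `|` Z)) = fun n => m n Y + m n Z).
    exact: cvgD.
  by apply/funext => n; have [[_ _ ->]] := Hm n.
- have [w <-] := hphi a.
  transitivity (mu [set s | Y (act phi (val w) s)]).
    by congr mu; apply/funext => s /=; rewrite act_word.
  elim: (val w) Y => [//|x u IHu] Y.
  by rewrite -(muI x Y); exact: IHu [set s | Y (phi (letter x) * s)%g].
Qed.

Theorem theorem6p12 (R : realType) (S : semigroupType) (hS : inhabited S)
    (X : finType) (phi : {multiplicative free_semigroup X -> S})
    (hphi : surjective_morphism phi)
    (hrev : left_reversible S)
    (hklawe : klawe_condition (semigroup1 S))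
    (hmax : maximal_cogrowth phi R) :
  left_amenable R S.
Proof.
have X0 : (0 < #|X|)%N.
  have [s] := hS; have [[[//|x w] _] _] := hphi s.
  by apply/card_gt0P; exists x.
apply: (left_amenable_of_almost_invariant hphi) => eps eps0.
exact: exists_almost_invariant_mean.
Qed.
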